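(* Let $H$ be a real separable Hilbert space with orthonormal basis $(e_n)_{n\ge 1}$, let $A$ be the infinitesimal generator of a $C_0$-semigroup $(S(t))_{t\ge 0}$ on $H$, and let $L(t)=\sum_{n=1}^\infty \beta_n L^n(t)e_n$, $t\ge 0$, where $(\beta_n)$ is a sequence of positive numbers and $L^n$, $n\ge 1$, are independent, identically distributed, càdlàg, real-valued Lévy processes whose common jump intensity (Lévy) measure $\nu$ is not identically $0$. Assume that the process $$X(t)=\int_0^t S(t-s)\,dL(s),\qquad t\ge 0,$$ i.e. the weak solution of $dX(t)=AX(t)\,dt+dL(t)$, $X(0)=0$, is an $H$-valued process, that $e_n\in D(A^* )$ for every $n$, where $A^*$ is the adjoint of $A$, and that $\beta_n$ does not converge to $0$ as $n\to\infty$. Then $X$ has no $H$-càdlàg modification.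
   Context: The series defining $L$ need not converge in $H$; it is understood as converging in a possibly larger Hilbert space $U\supset H$, and the integral defining $X$ is the stochastic convolution $\sum_n \beta_n\int_0^t S(t-s)e_n\,dL^n(s)$. That $X$ is an $H$-valued weak solution means in particular that $X$ is a measurable $H$-valued process such that, for every $n$, $s\mapsto\langle X(s),A^*e_n\rangle_H$ is almost surely locally integrable and, for every $t\ge 0$, almost surely $$\langle X(t),e_n\rangle_H=\int_0^t\langle X(s),A^*e_n\rangle_H\,ds+\beta_nL^n(t).$$ An $H$-càdlàg modification of $X$ is an $H$-valued process $Y$ with $\mathbb P(X(t)=Y(t))=1$ for every $t\ge 0$ whose trajectories are right-continuous with left limits in the norm of $H$. *)

(* Defs.v *)
From HB Require Import structures.
From mathcomp Require Export all_boot all_order all_algebra.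
From mathcomp Require Export finmap.
From mathcomp Require Export all_classical all_reals all_analysis.
From mathcomp Require Export sesquilinear.
Export Order.TTheory GRing.Theory Num.Theory.
Export numFieldNormedType.Exports.

Set Implicit Arguments.
Unset Strict Implicit.
Unset Printing Implicit Defensive.

Local Open Scope classical_set_scope.
Local Open Scope ring_scope.

(* A real Hilbert space is a [completeNormedModType R] together with an inner
   product [ip : {dot H for idfun}] inducing its norm. *)

Section hilbert.
Context {R : realType} {H : completeNormedModType R}.

Definition induces_norm (ip : {dot H for @idfun R}) : Prop :=
  forall x : H, ip x x = `|x| ^+ 2.

Definition separable_space (T : topologicalType) : Prop :=
  exists2 D : set T, countable D & closure D = setT.

Definition orthonormal_basis (ip : {dot H for @idfun R}) (e : nat -> H) : Prop :=
  (forall m n, ip (e m) (e n) = (m == n)%:R) /\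
  (forall x, [series ip x (e k) *: e k]_k @ \oo --> x).

(* Only the values [S t] with [0 <= t] are constrained. *)
Definition C0_semigroup (S : R -> {linear H -> H}) : Prop :=
  [/\ forall t, 0 <= t -> continuous (S t),
      forall x, S 0 x = x,
      forall s t, 0 <= s -> 0 <= t -> forall x, S (s + t) x = S s (S t x) &
      forall x, S t x @[t --> 0^'+] --> x].

Definition generator_dom (S : R -> {linear H -> H}) : set H :=
  [set x | cvg ((t^-1 *: (S t x - x)) @[t --> 0^'+])].

(* meaningful on [generator_dom S] only *)
Definition generator (S : R -> {linear H -> H}) (x : H) : H :=
  lim ((t^-1 *: (S t x - x)) @[t --> 0^'+]).

(* Adjoint of the unbounded operator [A] with domain [D]. When [D] is dense, as
   for generators, the vector selected by [adjoint] on [adjoint_dom] is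
   unique. *)
Definition adjoint_dom (ip : {dot H for @idfun R}) (D : set H) (A : H -> H) :
    set H :=
  [set y | exists z, forall x, D x -> ip (A x) y = ip x z].

Definition adjoint (ip : {dot H for @idfun R}) (D : set H) (A : H -> H)
    (y : H) : H :=
  xget 0 [set z | forall x, D x -> ip (A x) y = ip x z].

End hilbert.

(* Time is [R] restricted to [`[0, +oo[]; values of processes at negative times
   are irrelevant. *)

Section processes.
Context {R : realType} {d : measure_display} {Omega : measurableType d}.
Variable P : probability Omega R.

Definition borel (V : normedModType R) := g_sigma_algebraType (@open V).

Definition random_vector (V : normedModType R) (Z : Omega -> V) : Prop :=
  measurable_fun setT (Z : Omega -> borel V).

Definition process (V : normedModType R) (Z : R -> Omega -> V) : Prop :=
  forall t, 0 <= t -> random_vector (Z t).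

Definition measurable_process (V : normedModType R) (Z : R -> Omega -> V) :
    Prop :=
  @measurable_fun _ _ (measurableTypeR R * Omega)%type (borel V)
    (`[0, +oo[ `*` [set: Omega]) (fun p => Z p.1 p.2).

Definition modification (V : normedModType R) (Z Y : R -> Omega -> V) : Prop :=
  forall t, 0 <= t -> {ae P, forall w, Z t w = Y t w}.

Definition cadlag (V : ptopologicalType) (x : R -> V) : Prop :=
  (forall t, 0 <= t -> x s @[s --> t^'+] --> x t) /\
  (forall t, 0 < t -> cvg (x s @[s --> t^'-])).

Definition cvg_in_probability (V : normedModType R) (I : Type)
    (F : set_system I) (Z : I -> Omega -> V) (Y : Omega -> V) : Prop :=
  forall eps : R, 0 < eps ->
    P [set w | eps <= `|Z i w - Y w|] @[i --> F] --> 0%E.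

Definition independent_systems (I : choiceType) (G : I -> set (set Omega)) :
    Prop :=
  forall (J : {fset I}) (E : I -> set Omega),
    (forall i, i \in J -> G i (E i)) ->
    P (\bigcap_(i in [set` J]) E i) = (\prod_(i <- J) P (E i))%E.

Definition sigma_process (Z : R -> Omega -> R) : set (set Omega) :=
  <<s \bigcup_(t in `[0, +oo[) preimage_set_system setT (Z t) measurable >>.

Definition independent_processes (I : choiceType) (Z : I -> R -> Omega -> R) :
    Prop :=
  independent_systems (fun i => sigma_process (Z i)).

Definition identically_distributed (Z Y : R -> Omega -> R) : Prop :=
  forall (ts : seq R) (B : R -> set R),
    (forall t, t \in ts -> 0 <= t) -> (forall t, measurable (B t)) ->
    P [set w | forall t, t \in ts -> B t (Z t w)] =
    P [set w | forall t, t \in ts -> B t (Y t w)].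

Definition independent_increments (Z : R -> Omega -> R) : Prop :=
  forall t : nat -> R, (forall i, 0 <= t i) -> nondecreasing_seq t ->
    independent_systems (fun i =>
      preimage_set_system setT (fun w => Z (t i.+1) w - Z (t i) w) measurable).

Definition stationary_increments (Z : R -> Omega -> R) : Prop :=
  forall s t, 0 <= s -> 0 <= t -> forall B : set R, measurable B ->
    P [set w | B (Z (s + t) w - Z s w)] = P [set w | B (Z t w)].

Definition stochastically_continuous (Z : R -> Omega -> R) : Prop :=
  forall t : R, 0 <= t ->
    cvg_in_probability (within [set s | 0 <= s] (nbhs t)) Z (Z t).

Definition Levy_process (Z : R -> Omega -> R) : Prop :=
  [/\ forall t, 0 <= t -> measurable_fun setT (Z t),
      {ae P, forall w, Z 0 w = 0},
      independent_increments Z,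
      stationary_increments Z &
      stochastically_continuous Z].

Definition jump (x : R -> R) (s : R) : R := x s - lim (x r @[r --> s^'-]).

Definition jump_times (x : R -> R) (B : set R) : set R :=
  [set s | [/\ 0 < s, s <= 1, jump x s != 0 & B (jump x s)]].

(* [nu B] is the expected number of nonzero jumps with size in [B] per unit of
   time. *)
Definition jump_intensity (Z : R -> Omega -> R)
    (nu : {measure set (measurableTypeR R) -> \bar R}) : Prop :=
  forall B : set R, measurable B ->
    nu B = (\int[P]_w counting (jump_times (Z ^~ w) B))%E.

Definition Riemann_sum (V : lmodType R) (f : R -> V) (l : R -> R)
    (a : R) (s : seq R) : V :=
  \sum_(i < size s)
    (l (nth a (a :: s) i.+1) - l (nth a (a :: s) i)) *: f (nth a (a :: s) i).

Definition mesh_lt (delta a : R) (s : seq R) : Prop :=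
  forall i, (i < size s)%N ->
    nth a (a :: s) i.+1 - nth a (a :: s) i < delta.

(* [J] is [\int_0^t f(s) dl(s)] for a deterministic continuous [f]: the limit in
   probability of the left-point Riemann sums as the mesh tends to [0]. *)
Definition stochastic_integral (V : normedModType R) (f : R -> V)
    (l : R -> Omega -> R) (t : R) (J : Omega -> V) : Prop :=
  forall eps eta : R, 0 < eps -> 0 < eta ->
    exists2 delta : R, 0 < delta &
      forall s : seq R, itv_partition 0 t s -> mesh_lt delta 0 s ->
        (P [set w | (eps <= `|Riemann_sum f (l ^~ w) 0 s - J w|)%R] < eta%:E)%E.

Section equation.
Context {H U : completeNormedModType R}.
Variables (iota : {linear H -> U}) (e : nat -> H) (beta : nat -> R).
Variable Ln : nat -> R -> Omega -> R.

(* [iota] is the inclusion of [H] into the larger space [U] in which the series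
   defining [L] converges. *)
Definition noise (L : R -> Omega -> U) : Prop :=
  process L /\
  forall t, 0 <= t ->
    cvg_in_probability \oo
      (fun N w => \sum_(n < N) (beta n * Ln n t w) *: iota (e n)) (L t).

(* [X t = \sum_n beta_n \int_0^t S(t - s) e_n dL^n(s)]; each integral is an
   element of [H], and the sum is only required to converge in [U]. *)
Definition stochastic_convolution (S : R -> {linear H -> H})
    (X : R -> Omega -> H) : Prop :=
  forall t, 0 <= t -> exists J : nat -> Omega -> H,
    [/\ forall n, random_vector (J n),
        forall n, stochastic_integral (fun s => S (t - s) (e n)) (Ln n) t (J n) &
        cvg_in_probability \oo
          (fun N w => \sum_(n < N) beta n *: iota (J n w))
          (fun w => iota (X t w))].

Definition weak_solution (ip : {dot H for @idfun R})
    (S : R -> {linear H -> H}) (X : R -> Omega -> H) : Prop :=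
  let Astar := adjoint ip (generator_dom S) (generator S) in
  [/\ measurable_process X,
      forall n, {ae P, forall w, forall T, 0 <= T ->
        (@lebesgue_measure R).-integrable `[0, T]
          (fun s => (ip (X s w) (Astar (e n)))%:E)} &
      forall n t, 0 <= t -> {ae P, forall w,
        ip (X t w) (e n) =
          \int[@lebesgue_measure R]_(s in `[0, t]) ip (X s w) (Astar (e n))
          + beta n * Ln n t w}].

End equation.

End processes.

(* Main.v *)
Require Import Defs.
From mathcomp Require Import all_boot all_order all_algebra.
From mathcomp Require Import all_classical all_reals all_analysis.
From mathcomp Require Import ring lra.

Local Open Scope classical_set_scope.
Local Open Scope ring_scope.

(* Pairing a cadlag version Y of X with e_n, the drift term of the weak equation
   is continuous in time, so on fine grids the increments of <Y, e_n> are those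
   of beta_n L^n. Since the range of Y on [0, 1] is relatively compact,
   <Y(t), e_n> tends to 0 uniformly in t, which forces the oscillations of L^n
   to become small along those n with beta_n >= c, where c > 0 is such that
   there are infinitely many of them. But nu <> 0 gives p > 0 such
   that, on every fine enough grid, some increment of L^0 exceeds a fixed delta
   with probability at least p; the same holds for each L^n because they have
   the same law, and the reverse Fatou inequality shows that this happens for
   infinitely many such n on an event of probability at least p. *)

(** * Uniform decay of the coefficients of a cadlag path *)

(** Near [t] the path clusters at two points only, its value and its left limit; compactness of
    [[0, 1]] will make this local fact global. *)
Lemma cadlag_near {R : realType} {V : normedModType R} (y : R -> V)
    (t eps : R) :
  cadlag y -> 0 <= t -> 0 < eps ->
  exists l : V, \forall s \near t, 0 <= s ->
    `|y t - y s| < eps \/ `|l - y s| < eps.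
Proof.
move=> [yr yl] t0 e0.
have /(cvgr_dist_lt)/(_ _ e0) := yr _ t0.
rewrite near_withinE => R1.
move: t0; rewrite le_eqVlt => /predU1P[t0|t0].
  (* At time 0 there is no left limit, and [l] is a dummy value. *)
  exists 0; near=> s => s0; left.
  have [->|st] := eqVneq s t; first by rewrite subrr normr0.
  by apply: (near R1 s) => //; rewrite lt_neqAle eq_sym st -t0.
have /cvg_ex[l /cvgr_dist_lt/(_ _ e0)] := yl _ t0.
rewrite near_withinE => L1.
exists l; near=> s => s0.
have [st|ts|->] := ltgtP s t.
- by right; apply: (near L1 s).
- by left; apply: (near R1 s).
- by left; rewrite subrr normr0.
Unshelve. all: by end_near. Qed.

Section hilbert.
Context {R : realType} {H : completeNormedModType R}.
Context {ip : {dot H for @idfun R}} (hip : induces_norm ip).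
Context {e : nat -> H} (he : orthonormal_basis ip e).

Lemma norm_orthonormal n : `|e n| = 1.
Proof.
have := hip (e n); rewrite (proj1 he) eqxx/= => /esym/eqP.
by rewrite sqrf_eq1 => /orP[/eqP//|/eqP h]; have := normr_ge0 (e n); rewrite h; lra.
Qed.

Lemma coef_cvg0 (x : H) : ip x (e n) @[n --> \oo] --> 0.
Proof.
have /cvgP/cvg_series_cvg_0 := proj2 he x.
move=> /cvgr0_norm_lt h; apply/cvgr0Pnorm_lt => eps /h.
by apply: filterS => n; rewrite normrZ norm_orthonormal mulr1.
Qed.

Lemma coef_le_norm (x : H) n : `|ip x (e n)| <= `|x|.
Proof.
set a := ip x (e n).
(* The squared distance from [x] to its projection on the line of [e n] is [|x|^2 - a^2]. *)
have : 0 <= ip (x - a *: e n) (x - a *: e n) by rewrite hip exprn_ge0.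
have eC : ip (e n) x = a.
  by rewrite /a (hermC ip)/= expr0 mul1r.
rewrite linearBl !linearBr/= !linearZl_LR !linearZr_LR/= eC -/a.
rewrite (proj1 he) eqxx/= hip => h.
rewrite -(@ler_pXn2r _ 2) ?nnegrE// real_normK ?num_real//.
rewrite expr2 -subr_ge0; move: h; congr (_ <= _).
rewrite -[a *: _]/(a * _); ring.
Qed.

(** The coefficients of a fixed vector tend to 0 and [ip _ (e n)] is 1-Lipschitz, so they become
    small uniformly on a small ball. By [cadlag_near] and compactness, finitely many such balls
    contain the path on [[0, 1]]. *)
Lemma cadlag_coef_cvg0 (y : R -> H) (eps : R) : cadlag y -> 0 < eps ->
  \forall n \near \oo, forall t : R, 0 <= t <= 1 -> `|ip (y t) (e n)| < eps.
Proof.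
move=> cy e0.
have e20 : 0 < eps / 2 by rewrite divr_gt0.
have cpt : near_covering_within (`[0, 1]%classic : set R).
  exact/near_covering_withinP/compact_near_coveringP/segment_compact.
have/(_ _ \oo (fun n (t : R) => `|ip (y t) (e n)| < eps) _) := cpt.
have aux (l : H) : \forall n \near \oo, forall u, `|l - u| < eps / 2 ->
    `|ip u (e n)| < eps.
  have /cvgr0_norm_lt/(_ _ e20) := coef_cvg0 l.
  apply: filterS => n ln u lu; have := coef_le_norm (l - u) n.
  rewrite linearBl/= => h.
  rewrite -(subKr (ip l (e n)) (ip u (e n))); apply: le_lt_trans (ler_normB _ _) _.
  lra.
case.
- move=> t /=; rewrite in_itv/= => /andP[t0 t1].
  have [l hl] := cadlag_near _ _ _ cy t0 e20.
  near=> s n; rewrite /= in_itv/= => /andP[s0 s1].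
  have : `|y t - y s| < eps / 2 \/ `|l - y s| < eps / 2.
    by move: s0; near: s.
  by case; move: (y s); near: n; apply: aux.
- move=> N _ hN; exists N => // n /hN h t ht; exact: h.
Unshelve. all: by end_near. Qed.

End hilbert.

(** * Oscillations of real paths on the grids [i / (k + 1)] *)

(** Heine-Cantor, with the modulus written as the mesh of a grid. *)
Lemma continuous_segment_uniform {R : realType} (F : R -> R) (eps : R) :
  {within `[0, 1], continuous F} -> 0 < eps ->
  \forall k \near \oo, forall s t : R, 0 <= s <= 1 -> 0 <= t <= 1 ->
    `|s - t| <= k.+1%:R^-1 -> `|F s - F t| < eps.
Proof.
move=> /subspace_continuousP cF e0.
have e20 : 0 < eps / 2 by rewrite divr_gt0.
have cpt : near_covering_within (`[0, 1]%classic : set R).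
  exact/near_covering_withinP/compact_near_coveringP/segment_compact.
have/(_ _ \oo (fun k (s : R) => forall t : R, 0 <= t <= 1 ->
  `|s - t| <= k.+1%:R^-1 -> `|F s - F t| < eps) _) := cpt.
case.
- move=> x0; have [x ->] : exists x : R, x0 = x by exists x0.
  move=> {x0} xI.
  have /cvgr_dist_lt/(_ _ e20) := cF x xI.
  rewrite near_withinE => /nbhs_ballP[d /= d0 hd].
  have d20 : 0 < d / 2 by rewrite divr_gt0.
  near=> s k => /= sI t tI st.
  have xs : `|x - s| < d / 2 by near: s; exact: (@nbhsx_ballx _ _ x _ d20).
  have ks : k.+1%:R^-1 < d / 2 by near: k; exact: near_infty_natSinv_lt (PosNum d20).
  have st2 : `|s - t| < d / 2 by exact: le_lt_trans st ks.
  have xt : `|x - t| < d.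
    have -> : x - t = (x - s) + (s - t) by lra.
    by apply: le_lt_trans (ler_normD _ _) _; lra.
  have xsd : `|x - s| < d by lra.
  have h1 : `|F x - F s| < eps / 2 by exact: hd.
  have h2 : `|F x - F t| < eps / 2 by exact: hd.
  have -> : F s - F t = (F x - F t) - (F x - F s) by lra.
  by apply: le_lt_trans (ler_normB _ _) _; lra.
- move=> N _ hN; exists N => // n /hN h s t hs; exact: h.
Unshelve. all: by end_near. Qed.

(** Using grid points only keeps the times countable: the events are measurable, and almost sure
    identities at fixed times suffice. *)
Definition osc {R : realType} (x : R -> R) (delta : R) (k : nat) : Prop :=
  exists2 i, (i < k.+1)%N &
    delta < `|x (i.+1%:R / k.+1%:R) - x (i%:R / k.+1%:R)|.

(** The grid cell containing [s] ends at or after [s], where the path is close to [x s], and starts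
    strictly before [s], where it is close to the left limit. *)
Lemma osc_near_jump {R : realType} (x : R -> R) (delta s : R) : cadlag x ->
  0 < s <= 1 -> delta < `|jump x s| -> \forall k \near \oo, osc x delta k.
Proof.
move=> [xr xl] /andP[s0 s1] hj.
pose l : R := lim (x r @[r --> s^'-]).
(* Half the excess of the jump over [delta], to allow an error below [c] at each end of the cell. *)
pose c : R := (`|jump x s| - delta) / 2.
have c0 : 0 < c by rewrite divr_gt0// subr_gt0.
have /cvgr_dist_lt/(_ _ c0) := xr _ (ltW s0).
rewrite near_withinE => /nbhs_ballP[d1 /= d10 hr].
have /cvgr_dist_lt/(_ _ c0) := xl _ s0.
rewrite near_withinE => /nbhs_ballP[d2 /= d20 hl].
near=> k.
have k1 : k.+1%:R^-1 < d1 by near: k; exact: near_infty_natSinv_lt (PosNum d10).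
have k2 : k.+1%:R^-1 < d2 by near: k; exact: near_infty_natSinv_lt (PosNum d20).
have K0 : (0 : R) < k.+1%:R by rewrite ltr0n.
have : exists m, s * k.+1%:R <= m%:R.
  by exists k.+1; rewrite ler_piMl ?ler0n.
(* The least [m] with [s <= m / (k + 1)] is positive because [0 < s]; its predecessor [i] starts the
   cell. *)
move=> /ex_minnP[[|i]].
  by rewrite leNgt mulr_gt0.
move=> hi himin; exists i.
  by apply: himin; rewrite ler_piMl ?ler0n.
have hi' : i%:R < s * k.+1%:R.
  by rewrite ltNge; apply/negP => /himin; rewrite ltnn.
pose h : R := k.+1%:R^-1.
move: (k1 : h < d1) (k2 : h < d2) => {}k1 {}k2.
pose p : R := i%:R / k.+1%:R; pose q : R := i.+1%:R / k.+1%:R.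
rewrite -/p -/q.
have e1 : q = p + h by rewrite /p /q /h -natr1 mulrDl mul1r.
have a1 : p < s by rewrite /p ltr_pdivrMr.
have a2 : s <= q by rewrite /q ler_pdivlMr.
clearbody p q h.
have a3 : `|x s - x q| < c.
  move: a2; rewrite le_eqVlt => /predU1P[<-|a2]; first by rewrite subrr normr0.
  have bs : `|s - q| < d1 by rewrite ltr_norml; lra.
  exact: hr.
have a4 : `|l - x p| < c.
  have bs : `|s - p| < d2 by rewrite ltr_norml; lra.
  exact: hl.
have -> : delta = `|x s - l| - 2 * c by rewrite -[x s - l]/(jump x s) /c; lra.
set u := x q; set v := x p.
have : `|x s - l| <= `|u - v| + `|x s - u| + `|l - v|.
  have -> : x s - l = (u - v) + (x s - u) - (l - v) by lra.
  by apply: le_trans (ler_normB _ _) _; rewrite lerD2r ler_normD.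
by rewrite -/u -/v in a3 a4 *; lra.
Unshelve. all: by end_near. Qed.

(** * Oscillation probabilities of Levy processes *)

Section probability.
Context {R : realType} {d : measure_display} {Omega : measurableType d}.
Variable P : probability Omega R.
Import HBNNSimple.

Lemma measurable_lim_sup_set (E : nat -> set Omega) :
  (forall k, measurable (E k)) -> measurable (lim_sup_set E).
Proof.
move=> mE; apply: bigcap_measurable => // k _.
exact: bigcup_measurable.
Qed.

(** The tail unions decrease to the upper limit, and each contains some [E k] of probability at
    least [p]. *)
Lemma lim_sup_set_ge (E : nat -> set Omega) (p : \bar R) :
  (forall k, measurable (E k)) ->
  (forall N, exists2 k, (N <= k)%N & (p <= P (E k))%E) ->
  (p <= P (lim_sup_set E))%E.
Proof.
move=> mE hE.
have mU N : measurable (\bigcup_(k >= N) E k) by exact: bigcup_measurable.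
apply: cvge_ge (lim_sup_set_cvg P E mE _).
  apply: nearW => N; have [k Nk pk] := hE N.
  by apply: le_trans pk _; apply: le_measure; rewrite ?inE//; exact: bigcup_sup.
by rewrite (le_lt_trans (probability_le1 _ _)) ?ltry.
Qed.

(* [f] is not assumed measurable: the number of jumps need not be. *)
Lemma integral_ae0 (f : Omega -> \bar R) : (forall w, 0 <= f w)%E ->
  {ae P, forall w, f w = 0%E} -> (\int[P]_w f w = 0)%E.
Proof.
move=> f0 [N [mN PN0 hN]]; rewrite ge0_integralTE//; apply/eqP; rewrite eq_le.
apply/andP; split; last first.
  apply: ereal_sup_ubound; exists (cst_nnsfun _ 0%:nng) => //=.
  by rewrite sintegral0.
apply: ge_ereal_sup => _ [h hf <-].
rewrite sintegralEnnsfun fsbig1// => r /= r0.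
rewrite (_ : P _ = 0%E) ?mule0//; apply/eqP; rewrite -measure_le0 -PN0.
have mh : measurable (h @^-1` [set r]) by [].
apply: le_measure; rewrite ?inE//.
move=> w /= hw; apply: hN => /= fw0; have := hf w.
by rewrite fw0 hw lee_fin leNgt r0.
Qed.

Definition osc_event (Z : R -> Omega -> R) (delta : R) (k : nat) : set Omega :=
  [set w | osc (Z ^~ w) delta k].

Lemma measurable_osc_event (Z : R -> Omega -> R) (delta : R) (k : nat) :
  (forall t, 0 <= t -> measurable_fun setT (Z t)) ->
  measurable (osc_event Z delta k).
Proof.
move=> mZ.
rewrite (_ : osc_event _ _ _ = \bigcup_(i in `I_k.+1)
   [set w | delta < `|Z (i.+1%:R / k.+1%:R) w - Z (i%:R / k.+1%:R) w|]); last first.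
  by apply/seteqP; split => w [i ik h]; exists i.
apply: bigcup_measurable => i _.
have mf : measurable_fun setT
    (fun w => `|Z (i.+1%:R / k.+1%:R) w - Z (i%:R / k.+1%:R) w|).
  by apply: measurableT_comp => //; apply: measurable_realfun.measurable_funB;
    apply: mZ; rewrite divr_ge0.
have := mf measurableT _ (measurable_itv `]delta, +oo[).
rewrite setTI; congr measurable; apply/seteqP; split => w /=;
  by rewrite in_itv/= andbT.
Qed.

(* The increments over the grid are i.i.d., so both probabilities are functions
   of the law of the process at the single time 1/(k+1). *)
Lemma Levy_osc_event (Z Z' : R -> Omega -> R) (delta : R) (k : nat) :
  Levy_process P Z -> Levy_process P Z' -> identically_distributed P Z Z' ->
  P (osc_event Z delta k) = P (osc_event Z' delta k).
Proof.
have [J memJ] : exists J : {fset nat}, forall i, (i \in J) = (i < k.+1)%N.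
  by exists [fset j in iota 0 k.+1]%fset => i;
    rewrite in_fset -[LHS]/(i \in iota 0 k.+1) mem_iota.
have osc_prod (Y : R -> Omega -> R) : Levy_process P Y ->
    P (~` osc_event Y delta k) = (\prod_(i <- J)
      P [set w | `|Y (k.+1%:R^-1) w| <= delta]%R)%E.
  move=> [mY _ iY sY _].
  pose t (i : nat) : R := i%:R / k.+1%:R.
  have t0 i : 0 <= t i by rewrite divr_ge0.
  have tnd : nondecreasing_seq t.
    by move=> i j ij; rewrite ler_pM2r ?invr_gt0 ?ltr0n// ler_nat.
  pose B : set R := [set x | `|x| <= delta].
  have mB : measurable B.
    have := measurable_itv `[- delta, delta]; congr measurable.
    by apply/seteqP; split => x; rewrite /B /= in_itv/= ler_norml.
  (* No oscillation means that all [k + 1] increments stay in [B]; independence turns this into a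
     product. *)
  have -> : ~` osc_event Y delta k =
    \bigcap_(i in [set` J])
      [set w | B (Y (t i.+1) w - Y (t i) w)].
    apply/seteqP; split => w /=.
      move=> h i /=; rewrite memJ => ik; rewrite /B/= leNgt.
      by apply/negP => hi; apply: h; exists i.
    move=> h [i ik]; rewrite ltNge => /negP; apply.
    by apply: h; rewrite /= memJ.
  rewrite (iY t t0 tnd); last first.
    by move=> i _ /=; exists B => //; rewrite setTI.
  apply: eq_bigr => i _.
  have -> : t i.+1 = t i + k.+1%:R^-1 by rewrite /t -natr1 mulrDl mul1r.
  by rewrite sY// invr_ge0.
move=> lZ lZ' idZ.
have cE (Y : R -> Omega -> R) : Levy_process P Y ->
    P (osc_event Y delta k) = (1 - P (~` osc_event Y delta k))%E.
  move=> [mY _ _ _ _]; rewrite -probability_setC ?setCK//.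
  by apply: measurableC; exact: measurable_osc_event.
rewrite !cE// !osc_prod//; congr (_ - _)%E; apply: eq_bigr => i _.
pose B : set R := [set x | `|x| <= delta].
have mB : measurable B.
  have := measurable_itv `[- delta, delta]; congr measurable.
  by apply/seteqP; split => x; rewrite /B /= in_itv/= ler_norml.
have := idZ [:: k.+1%:R^-1] (fun=> B) _ (fun=> mB).
have E (Y : R -> Omega -> R) :
    [set w | forall t, t \in [:: k.+1%:R^-1 : R] -> B (Y t w)] =
    [set w | `|Y (k.+1%:R^-1) w| <= delta].
  apply/seteqP; split => w /=.
    by apply; rewrite inE.
  by move=> h t; rewrite inE => /eqP ->.
rewrite !E; apply.
by move=> t; rewrite inE => /eqP ->; rewrite invr_ge0.
Qed.

(** If every [E j m] were null, [osc_near_jump] would leave almost every path without jumps in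
    [(0, 1]], and the expected number of jumps [nu B] would be 0. *)
Lemma jump_intensity_osc (Z : R -> Omega -> R)
    (nu : {measure set (measurableTypeR R) -> \bar R}) :
  (forall t, 0 <= t -> measurable_fun setT (Z t)) ->
  (forall w, cadlag (Z ^~ w)) -> jump_intensity P Z nu ->
  (exists2 B : set R, measurable B & nu B <> 0%E) ->
  exists delta p : R, [/\ 0 < delta, 0 < p &
    \forall k \near \oo, (p%:E <= P (osc_event Z delta k))%E].
Proof.
move=> mZ cZ hnu [B mB nuB].
pose E (j m : nat) : set Omega := \bigcap_(k >= m) osc_event Z j.+1%:R^-1 k.
have mE j m : measurable (E j m).
  by apply: bigcap_measurableType => k _; exact: measurable_osc_event.
have [[j [m Pjm]]|noE] := pselect (exists j m, P (E j m) <> 0%E).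
  exists j.+1%:R^-1, (fine (P (E j m))).
  split; first by rewrite invr_gt0.
    rewrite fine_gt0// (le_lt_trans (probability_le1 _ _)) ?ltry// andbT.
    by rewrite lt_neqAle measure_ge0 andbT eq_sym; apply/eqP.
  exists m => // k mk; rewrite /= fineK ?fin_num_measure//.
  apply: le_measure; rewrite ?inE//; first exact: measurable_osc_event.
  exact: bigcap_inf.
exfalso; apply: nuB; rewrite hnu//; apply: integral_ae0 => //.
have nE : P.-negligible (\bigcup_j \bigcup_m E j m).
  do 2!apply: negligible_bigcup => ?; apply/negligibleP => //.
  by apply: contrapT => h; apply: noE; do 2!eexists; exact: h.
apply: negligibleS nE => w /= hw.
have [s [s0 s1 sj _]] : jump_times (Z ^~ w) B !=set0.
  by apply/set0P/eqP => h; apply: hw; rewrite h measure0.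
have js0 : 0 < `|jump (Z ^~ w) s| by rewrite normr_gt0.
have [j _ hj] : \forall j \near \oo, j.+1%:R^-1 < `|jump (Z ^~ w) s|.
  exact: near_infty_natSinv_lt (PosNum js0).
exists j => //.
have js : j.+1%:R^-1 < `|jump (Z ^~ w) s| by exact: (hj j (leqnn j)).
have s01 : 0 < s <= 1 by rewrite s0.
have [m _ hm] := osc_near_jump (Z ^~ w) j.+1%:R^-1 s (cZ w) s01 js.
by exists m => // k; exact: hm.
Qed.

End probability.

(** * Pathwise bound and conclusion *)

(** An increment of [beta n * l n] is one of the coefficient minus one of [F n]; both are small. The
    bound on [k] depends on [n] through the modulus of continuity of [F n]. *)
Lemma not_osc_cadlag {R : realType} {H : completeNormedModType R}
    (ip : {dot H for @idfun R}) (e : nat -> H) (y : R -> H)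
    (F l : nat -> R -> R) (beta : nat -> R) (c delta : R) :
  induces_norm ip -> orthonormal_basis ip e -> cadlag y ->
  (forall n, {within `[0, 1], continuous (F n)}) ->
  (forall n k i, ip (y (i%:R / k.+1%:R)) (e n) =
    F n (i%:R / k.+1%:R) + beta n * l n (i%:R / k.+1%:R)) ->
  0 < c -> 0 < delta ->
  \forall n \near \oo, c <= beta n -> \forall k \near \oo, ~ osc (l n) delta k.
Proof.
move=> hip he cy cF yE c0 delta0.
have cd0 : 0 < c * delta by rewrite mulr_gt0.
(* Two coefficients below [c * delta / 4] and a drift increment below [c * delta / 2] add up to at
   most [c * delta]. *)
have cd4 : 0 < c * delta / 4 by rewrite divr_gt0.
have cd2 : 0 < c * delta / 2 by rewrite divr_gt0.
apply: filterS (cadlag_coef_cvg0 hip he y _ cy cd4) => n hy cb.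
apply: filterS (continuous_segment_uniform (F n) _ (cF n) cd2) => k hF [i ik].
have K0 : (0 : R) < k.+1%:R by rewrite ltr0n.
have grid01 j : (j <= k.+1)%N -> 0 <= (j%:R / k.+1%:R : R) <= 1.
  by move=> jk; rewrite divr_ge0// ler_pdivrMr// mul1r ler_nat.
have i01 := grid01 _ (ltnW ik); have i101 := grid01 _ ik.
have step : `|i.+1%:R / k.+1%:R - i%:R / k.+1%:R| <= k.+1%:R^-1 :> R.
  by rewrite -mulrBl -natr1 addrAC subrr add0r mul1r ger0_norm// invr_ge0.
have := hF _ _ i101 i01 step; have := hy _ i01; have := hy _ i101; rewrite !yE.
move: (F n _) (F n _) (l n _) (l n _) => a b u v hbv hau hab huv.
have b0 : 0 < beta n by exact: lt_le_trans cb.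
have : c * delta < `|beta n * (v - u)|.
  rewrite normrM gtr0_norm//; apply: (@le_lt_trans _ _ (beta n * delta)).
    by rewrite ler_pM2r.
  by rewrite ltr_pM2l.
apply/negP; rewrite -leNgt.
have -> : beta n * (v - u) = (b + beta n * v) - (a + beta n * u) - (b - a) by ring.
apply: le_trans (ler_normB _ _) _.
apply: (@le_trans _ _ (c * delta / 4 + c * delta / 4 + c * delta / 2)).
  apply: lerD; last by rewrite ltW.
  by apply: le_trans (ler_normB _ _) _; rewrite lerD// ltW.
lra.
Qed.

Theorem corollary2p1 (R : realType)
  (d : measure_display) (Omega : measurableType d) (P : probability Omega R)
  (H : completeNormedModType R) (ip : {dot H for @idfun R})
  (hip : induces_norm ip) (hsep : separable_space H)
  (e : nat -> H) (he : orthonormal_basis ip e)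
  (S : R -> {linear H -> H}) (hS : C0_semigroup S)
  (U : completeNormedModType R) (ipU : {dot U for @idfun R})
  (hipU : induces_norm ipU)
  (iota : {linear H -> U}) (iota_cont : continuous iota)
  (iota_inj : injective iota)
  (beta : nat -> R) (hbeta : forall n, 0 < beta n)
  (Ln : nat -> R -> Omega -> R)
  (hLevy : forall n, Levy_process P (Ln n))
  (hcadlag : forall n w, cadlag (Ln n ^~ w))
  (hindep : independent_processes P Ln)
  (hid : forall m n, identically_distributed P (Ln m) (Ln n))
  (nu : {measure set (measurableTypeR R) -> \bar R})
  (hnu : forall n, jump_intensity P (Ln n) nu)
  (nu_neq0 : exists2 B : set R, measurable B & nu B <> 0%E)
  (L : R -> Omega -> U) (hL : noise P iota e beta Ln L)
  (X : R -> Omega -> H)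
  (hconv : stochastic_convolution P iota e beta Ln S X)
  (hweak : weak_solution P e beta Ln ip S X)
  (heA : forall n, adjoint_dom ip (generator_dom S) (generator S) (e n))
  (hbeta_lim : ~ (beta @ \oo --> 0)) :
  ~ exists Y : R -> Omega -> H,
      [/\ process Y, modification P X Y & forall w, cadlag (Y ^~ w)].
Proof.
move=> [Y [_ XY cY]].
have [c c0 hc] : exists2 c, 0 < c & forall N, exists2 n, (N <= n)%N & c <= beta n.
  apply: contrapT => noc; apply: hbeta_lim; apply/cvgr0Pnorm_lt => eps eps0.
  apply: contrapT => hn; apply: noc; exists eps => // N.
  apply: contrapT => hN; apply: hn; exists N => // n Nn /=.
  by rewrite gtr0_norm// ltNge; apply/negP => hb; apply: hN; exists n.
have mL n t : 0 <= t -> measurable_fun setT (Ln n t).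
  by case: (hLevy n) => + _ _ _ _; apply.
have [delta [p [delta0 p0 [K _ hK]]]] :=
  jump_intensity_osc P (Ln 0%N) nu (mL 0%N) (hcadlag 0%N) (hnu 0%N) nu_neq0.
(* Two upper limits are nested: over grids here, then over [n]. *)
pose F n := lim_sup_set (osc_event (Ln n) delta).
have mF n : measurable (F n).
  by apply: measurable_lim_sup_set => k; exact/measurable_osc_event/mL.
have PF n : (p%:E <= P (F n))%E.
  apply: lim_sup_set_ge => [k|N]; first exact/measurable_osc_event/mL.
  exists (maxn N K); first exact: leq_maxl.
  rewrite (Levy_osc_event P _ (Ln 0%N))//.
  exact/hK/leq_maxr.
(* Emptying the other indices makes the upper limit see only those with [c <= beta n]. *)
pose E n := if c <= beta n then F n else set0.
have mE n : measurable (E n) by rewrite /E; case: ifP.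
have PE : (p%:E <= P (lim_sup_set E))%E.
  apply: lim_sup_set_ge => // N; have [n Nn cn] := hc N.
  by exists n => //; rewrite /E cn.
case: hweak => _ iX eX.
pose drift n w t := \int[@lebesgue_measure R]_(s in `[0, t])
  ip (X s w) (adjoint ip (generator_dom S) (generator S) (e n)).
(* Countably many grid times and indices: a single null set serves for all of them. *)
have aeY : {ae P, forall w n k i, ip (Y (i%:R / k.+1%:R) w) (e n) =
    drift n w (i%:R / k.+1%:R) + beta n * Ln n (i%:R / k.+1%:R) w}.
  apply: ae_foralln => n; apply: ae_foralln => k; apply: ae_foralln => i.
  set t := _ / _; have t0 : 0 <= t by rewrite divr_ge0.
  by apply: filterS2 (XY t t0) (eX n t t0) => w <-.
have aeI : {ae P, forall w n, {within `[0, 1], continuous (drift n w)}}.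
  apply: ae_foralln => n; apply: filterS (iX n) => w hw.
  exact: parameterized_integral_continuous ler01 (hw 1 ler01).
have : P.-negligible (lim_sup_set E).
  have : {ae P, forall w, ~ lim_sup_set E w}.
    apply: filterS2 aeY aeI => w hY hI wE.
    have [N _ hN] := not_osc_cadlag ip e _ _ (fun n t => Ln n t w) beta c delta
      hip he (cY w) hI hY c0 delta0.
    have [n Nn] := wE N I.
    rewrite /E; case: ifP => // cn wF.
    have [k0 _ hk0] := hN n Nn cn.
    have [k k0k] := wF k0 I.
    exact: hk0.
  by apply: negligibleS => w wE; apply.
move/negligibleP => /(_ (measurable_lim_sup_set _ mE)) P0.
by move: PE; rewrite P0 lee_fin leNgt p0.
Qed.
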